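(* For all formulae $A,B$, the following formulae are derivable in $\mathbf{GIUL}$: (1) $(\boxdot A\land\boxdot B)\to\boxdot(A\land B)$; (2) $(\Diamond A\land\Diamond B)\to\Diamond(A\land B)$; (3) $\boxdot(A\lor B)\to(\boxdot A\lor\boxdot B)$; (4) $\Diamond(A\lor B)\to(\Diamond A\lor\Diamond B)$.
   Context: Formulae are built from propositional variables and constants $0,1,\bot,\top$ using the connectives $\otimes$, $\oplus$ (multiplicative disjunction, ''par''), $\land$, $\lor$ (additive conjunction and disjunction), $\neg$, $\to$. A sequent $\Gamma\Rightarrow\Delta$ is a pair of finite multisets of formulae; a hypersequent is a finite multiset of sequents, written with separator $\mid$. A formula $C$ is derivable in $\mathbf{GIUL}$ if the hypersequent consisting of the single sequent ${}\Rightarrow C$ is derivable. The hypersequent calculus $\mathbf{GIUL}$ for Involutive Uninorm Logic has the following rules, where $\mathcal{H}$ is an arbitrary, possibly empty, hypersequent. Axioms: $A\Rightarrow A$; $0\Rightarrow{}$; ${}\Rightarrow 1$; $\bot,\Gamma\Rightarrow\Delta$; $\Gamma\Rightarrow\Delta,\top$. $(R0)$ from $\mathcal{H}\mid\Gamma\Rightarrow\Delta$ infer $\mathcal{H}\mid\Gamma\Rightarrow\Delta,0$. $(L1)$ from $\mathcal{H}\mid\Gamma\Rightarrow\Delta$ infer $\mathcal{H}\mid 1,\Gamma\Rightarrow\Delta$. $(L\otimes)$ from $\mathcal{H}\mid\Gamma,A,B\Rightarrow\Delta$ infer $\mathcal{H}\mid A\otimes B,\Gamma\Rightarrow\Delta$.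 $(R\otimes)$ from $\mathcal{H}\mid\Gamma\Rightarrow\Delta,A$ and $\mathcal{H}\mid\Gamma'\Rightarrow\Delta',B$ infer $\mathcal{H}\mid\Gamma,\Gamma'\Rightarrow\Delta,\Delta',A\otimes B$. $(L\oplus)$ from $\mathcal{H}\mid A,\Gamma\Rightarrow\Delta$ and $\mathcal{H}\mid B,\Gamma'\Rightarrow\Delta'$ infer $\mathcal{H}\mid A\oplus B,\Gamma,\Gamma'\Rightarrow\Delta,\Delta'$. $(R\oplus)$ from $\mathcal{H}\mid\Gamma\Rightarrow\Delta,A,B$ infer $\mathcal{H}\mid\Gamma\Rightarrow\Delta,A\oplus B$. $(L\land_1),(L\land_2)$ from $\mathcal{H}\mid A,\Gamma\Rightarrow\Delta$, respectively from $\mathcal{H}\mid B,\Gamma\Rightarrow\Delta$, infer $\mathcal{H}\mid A\land B,\Gamma\Rightarrow\Delta$. $(R\land)$ from $\mathcal{H}\mid\Gamma\Rightarrow\Delta,A$ and $\mathcal{H}\mid\Gamma\Rightarrow\Delta,B$ infer $\mathcal{H}\mid\Gamma\Rightarrow\Delta,A\land B$. $(L\lor)$ from $\mathcal{H}\mid A,\Gamma\Rightarrow\Delta$ and $\mathcal{H}\mid B,\Gamma\Rightarrow\Delta$ infer $\mathcal{H}\mid A\lor B,\Gamma\Rightarrow\Delta$. $(R\lor_1),(R\lor_2)$ from $\mathcal{H}\mid\Gamma\Rightarrow\Delta,A$, respectively from $\mathcal{H}\mid\Gamma\Rightarrow\Delta,B$, infer $\mathcal{H}\mid\Gamma\Rightarrow\Delta,A\lor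 B$. $(L\neg)$ from $\mathcal{H}\mid\Gamma\Rightarrow\Delta,A$ infer $\mathcal{H}\mid\neg A,\Gamma\Rightarrow\Delta$. $(R\neg)$ from $\mathcal{H}\mid A,\Gamma\Rightarrow\Delta$ infer $\mathcal{H}\mid\Gamma\Rightarrow\Delta,\neg A$. $(L\to)$ from $\mathcal{H}\mid\Gamma\Rightarrow\Delta,A$ and $\mathcal{H}\mid B,\Gamma'\Rightarrow\Delta'$ infer $\mathcal{H}\mid A\to B,\Gamma,\Gamma'\Rightarrow\Delta,\Delta'$. $(R\to)$ from $\mathcal{H}\mid A,\Gamma\Rightarrow\Delta,B$ infer $\mathcal{H}\mid\Gamma\Rightarrow\Delta,A\to B$. $(EW)$ from $\mathcal{H}$ infer $\mathcal{H}\mid\Gamma\Rightarrow\Delta$. $(EC)$ from $\mathcal{H}\mid\Gamma\Rightarrow\Delta\mid\Gamma\Rightarrow\Delta$ infer $\mathcal{H}\mid\Gamma\Rightarrow\Delta$. $(Com)$ from $\mathcal{H}\mid\Gamma_1,\Pi_1\Rightarrow\Sigma_1,\Delta_1$ and $\mathcal{H}\mid\Gamma_2,\Pi_2\Rightarrow\Sigma_2,\Delta_2$ infer $\mathcal{H}\mid\Gamma_1,\Gamma_2\Rightarrow\Delta_1,\Delta_2\mid\Pi_1,\Pi_2\Rightarrow\Sigma_1,\Sigma_2$. The Tarskian modalities are the abbreviations $\Diamond A := \neg A\to A$ and $\boxdot A := \neg\Diamond\neg A$. *)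

(* Defs.v *)
From HB Require Import structures.
From mathcomp Require Import all_boot finmap multiset.

Set Implicit Arguments.
Unset Strict Implicit.
Unset Printing Implicit Defensive.

Local Open Scope mset_scope.

Inductive formula : Type :=
  | Var of nat
  | Zero
  | One
  | Bot
  | Top
  | Tensor of formula & formula
  | Par of formula & formula
  | And of formula & formula
  | Or of formula & formula
  | Not of formula
  | Imp of formula & formula.

Declare Scope formula_scope.
Delimit Scope formula_scope with F.
Bind Scope formula_scope with formula.

Notation "A ⊗ B" := (Tensor A B) (at level 70, right associativity) : formula_scope.
Notation "A ⊕ B" := (Par A B) (at level 70, right associativity) : formula_scope.
Notation "A ∧ B" := (And A B) (at level 80, right associativity) : formula_scope.
Notation "A ∨ B" := (Or A B) (at level 85, right associativity) : formula_scope.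
Notation "¬ A" := (Not A) (at level 75, right associativity) : formula_scope.
Notation "A → B" := (Imp A B)
  (at level 99, B at level 200, right associativity) : formula_scope.

(* Multisets are formed over a choiceType, obtained here by encoding formulae
   as finitely branching trees with connective-labelled nodes. *)
Fixpoint formula_encode (A : formula) : GenTree.tree nat :=
  match A with
  | Var p => GenTree.Leaf p
  | Zero => GenTree.Node 0 [::]
  | One => GenTree.Node 1 [::]
  | Bot => GenTree.Node 2 [::]
  | Top => GenTree.Node 3 [::]
  | Tensor B C => GenTree.Node 4 [:: formula_encode B; formula_encode C]
  | Par B C => GenTree.Node 5 [:: formula_encode B; formula_encode C]
  | And B C => GenTree.Node 6 [:: formula_encode B; formula_encode C]
  | Or B C => GenTree.Node 7 [:: formula_encode B; formula_encode C]
  | Not B => GenTree.Node 8 [:: formula_encode B]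
  | Imp B C => GenTree.Node 9 [:: formula_encode B; formula_encode C]
  end.

Fixpoint formula_decode (t : GenTree.tree nat) : formula :=
  match t with
  | GenTree.Leaf p => Var p
  | GenTree.Node 0 _ => Zero
  | GenTree.Node 1 _ => One
  | GenTree.Node 2 _ => Bot
  | GenTree.Node 4 [:: t1; t2] => Tensor (formula_decode t1) (formula_decode t2)
  | GenTree.Node 5 [:: t1; t2] => Par (formula_decode t1) (formula_decode t2)
  | GenTree.Node 6 [:: t1; t2] => And (formula_decode t1) (formula_decode t2)
  | GenTree.Node 7 [:: t1; t2] => Or (formula_decode t1) (formula_decode t2)
  | GenTree.Node 8 [:: t1] => Not (formula_decode t1)
  | GenTree.Node 9 [:: t1; t2] => Imp (formula_decode t1) (formula_decode t2)
  | _ => Top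
  end.

Lemma formula_encodeK : cancel formula_encode formula_decode.
Proof.
by elim=> //= [B -> C -> | B -> C -> | B -> C -> | B -> C -> | B -> | B -> C ->].
Qed.

HB.instance Definition _ := Countable.copy formula (can_type formula_encodeK).

Definition sequent : Type := ({mset formula} * {mset formula})%type.
HB.instance Definition _ := Choice.on sequent.

Definition hypersequent : Type := {mset sequent}.

Definition Seq (Γ Δ : {mset formula}) : sequent := (Γ, Δ).

Notation "Γ ⇒ Δ" := (Seq Γ%mset Δ%mset) (at level 90, no associativity).
Notation "H ∥ S" := (msetD H%mset [mset S])
  (at level 94, left associativity) : mset_scope.

Inductive GIUL : hypersequent -> Prop :=
  | Ax (A : formula) : GIUL [mset [mset A] ⇒ [mset A]]
  | L0 : GIUL [mset [mset Zero] ⇒ mset0]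
  | R1 : GIUL [mset mset0 ⇒ [mset One]]
  | LBot (Γ Δ : {mset formula}) : GIUL [mset Bot +` Γ ⇒ Δ]
  | RTop (Γ Δ : {mset formula}) : GIUL [mset Γ ⇒ Top +` Δ]
  | R0 (H : hypersequent) (Γ Δ : {mset formula}) :
      GIUL (H ∥ Γ ⇒ Δ) ->
      GIUL (H ∥ Γ ⇒ Zero +` Δ)
  | L1 (H : hypersequent) (Γ Δ : {mset formula}) :
      GIUL (H ∥ Γ ⇒ Δ) ->
      GIUL (H ∥ One +` Γ ⇒ Δ)
  | LTensor (H : hypersequent) (Γ Δ : {mset formula}) (A B : formula) :
      GIUL (H ∥ A +` (B +` Γ) ⇒ Δ) ->
      GIUL (H ∥ (A ⊗ B)%F +` Γ ⇒ Δ)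
  | RTensor (H : hypersequent) (Γ Γ' Δ Δ' : {mset formula}) (A B : formula) :
      GIUL (H ∥ Γ ⇒ A +` Δ) ->
      GIUL (H ∥ Γ' ⇒ B +` Δ') ->
      GIUL (H ∥ Γ `+` Γ' ⇒ (A ⊗ B)%F +` (Δ `+` Δ'))
  | LPar (H : hypersequent) (Γ Γ' Δ Δ' : {mset formula}) (A B : formula) :
      GIUL (H ∥ A +` Γ ⇒ Δ) ->
      GIUL (H ∥ B +` Γ' ⇒ Δ') ->
      GIUL (H ∥ (A ⊕ B)%F +` (Γ `+` Γ') ⇒ Δ `+` Δ')
  | RPar (H : hypersequent) (Γ Δ : {mset formula}) (A B : formula) :
      GIUL (H ∥ Γ ⇒ A +` (B +` Δ)) ->
      GIUL (H ∥ Γ ⇒ (A ⊕ B)%F +` Δ)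
  | LAnd1 (H : hypersequent) (Γ Δ : {mset formula}) (A B : formula) :
      GIUL (H ∥ A +` Γ ⇒ Δ) ->
      GIUL (H ∥ (A ∧ B)%F +` Γ ⇒ Δ)
  | LAnd2 (H : hypersequent) (Γ Δ : {mset formula}) (A B : formula) :
      GIUL (H ∥ B +` Γ ⇒ Δ) ->
      GIUL (H ∥ (A ∧ B)%F +` Γ ⇒ Δ)
  | RAnd (H : hypersequent) (Γ Δ : {mset formula}) (A B : formula) :
      GIUL (H ∥ Γ ⇒ A +` Δ) ->
      GIUL (H ∥ Γ ⇒ B +` Δ) ->
      GIUL (H ∥ Γ ⇒ (A ∧ B)%F +` Δ)
  | LOr (H : hypersequent) (Γ Δ : {mset formula}) (A B : formula) :
      GIUL (H ∥ A +` Γ ⇒ Δ) ->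
      GIUL (H ∥ B +` Γ ⇒ Δ) ->
      GIUL (H ∥ (A ∨ B)%F +` Γ ⇒ Δ)
  | ROr1 (H : hypersequent) (Γ Δ : {mset formula}) (A B : formula) :
      GIUL (H ∥ Γ ⇒ A +` Δ) ->
      GIUL (H ∥ Γ ⇒ (A ∨ B)%F +` Δ)
  | ROr2 (H : hypersequent) (Γ Δ : {mset formula}) (A B : formula) :
      GIUL (H ∥ Γ ⇒ B +` Δ) ->
      GIUL (H ∥ Γ ⇒ (A ∨ B)%F +` Δ)
  | LNot (H : hypersequent) (Γ Δ : {mset formula}) (A : formula) :
      GIUL (H ∥ Γ ⇒ A +` Δ) ->
      GIUL (H ∥ (¬ A)%F +` Γ ⇒ Δ)
  | RNot (H : hypersequent) (Γ Δ : {mset formula}) (A : formula) :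
      GIUL (H ∥ A +` Γ ⇒ Δ) ->
      GIUL (H ∥ Γ ⇒ (¬ A)%F +` Δ)
  | LImp (H : hypersequent) (Γ Γ' Δ Δ' : {mset formula}) (A B : formula) :
      GIUL (H ∥ Γ ⇒ A +` Δ) ->
      GIUL (H ∥ B +` Γ' ⇒ Δ') ->
      GIUL (H ∥ (A → B)%F +` (Γ `+` Γ') ⇒ Δ `+` Δ')
  | RImp (H : hypersequent) (Γ Δ : {mset formula}) (A B : formula) :
      GIUL (H ∥ A +` Γ ⇒ B +` Δ) ->
      GIUL (H ∥ Γ ⇒ (A → B)%F +` Δ)
  | EW (H : hypersequent) (Γ Δ : {mset formula}) :
      GIUL H ->
      GIUL (H ∥ Γ ⇒ Δ)
  | EC (H : hypersequent) (Γ Δ : {mset formula}) :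
      GIUL (H ∥ Γ ⇒ Δ ∥ Γ ⇒ Δ) ->
      GIUL (H ∥ Γ ⇒ Δ)
  | Com (H : hypersequent) (Γ1 Γ2 Π1 Π2 Σ1 Σ2 Δ1 Δ2 : {mset formula}) :
      GIUL (H ∥ Γ1 `+` Π1 ⇒ Σ1 `+` Δ1) ->
      GIUL (H ∥ Γ2 `+` Π2 ⇒ Σ2 `+` Δ2) ->
      GIUL (H ∥ Γ1 `+` Γ2 ⇒ Δ1 `+` Δ2 ∥ Π1 `+` Π2 ⇒ Σ1 `+` Σ2).

Definition derivable (C : formula) : Prop := GIUL [mset mset0 ⇒ [mset C]].
Arguments derivable C%_F.

Definition diamond (A : formula) : formula := (¬ A → A)%F.
Notation "◇ A" := (diamond A) (at level 75, right associativity) : formula_scope.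

Definition boxdot (A : formula) : formula := (¬ ◇ ¬ A)%F.
Notation "⊡ A" := (boxdot A) (at level 75, right associativity) : formula_scope.

(* Main.v *)
Require Import Defs.
From mathcomp Require Import all_boot.
From mathcomp Require Import finmap multiset.

(** In a linearly ordered model a monotone operation preserves binary meets
    and joins, because the meet and the join of two elements are among these
    two elements.  The proof replays this argument with hypersequents.  The
    communication rule makes [A ⇒ B | B ⇒ A] derivable, and from it follow the
    two forms of selectivity: [A ⇒ A ∧ B | B ⇒ A ∧ B], the meet being one of
    its arguments ([and_selective]), and [A ∨ B ⇒ A | A ∨ B ⇒ B], the join being
    one of its arguments ([or_selective]).  A modality that is monotone in
    every hypersequent context can be put on both sides of each component.
    Then the additive rules turn the two components into equal ones, and
    external contraction merges them ([monotone_and], [monotone_or]).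

    It remains that both modalities are monotone.  Up to provable equivalence
    [◇ A] is [A ⊕ A] and [⊡ A] is [A ⊗ A]; hence one of the rules that
    introduce the modality takes two copies of the argument in one premise,
    and the other takes one copy in each of two premises.  Two uses of the same
    component [A ⇒ B] give both copies. *)

Local Open Scope mset_scope.

(** * Selectivity of the lattice connectives *)

Lemma hyper_swap (H : hypersequent) (S T : sequent) :
  GIUL (H ∥ S ∥ T) -> GIUL (H ∥ T ∥ S).
Proof. by rewrite msetDAC. Qed.

Lemma ax_weak (S : sequent) (A : formula) :
  GIUL (mset0 ∥ S ∥ [mset A] ⇒ [mset A]).
Proof.
case: S => Γ Δ; apply: hyper_swap; rewrite mset0D.
exact: EW (Ax A).
Qed.

Lemma linearity (A B : formula) :
  GIUL (mset0 ∥ [mset A] ⇒ [mset B] ∥ [mset B] ⇒ [mset A]).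
Proof.
(* Each premise gives its antecedent to one component and its succedent to the
   other. *)
have := @Com mset0 [mset A] mset0 mset0 [mset B] [mset A] mset0 mset0 [mset B].
rewrite !msetD0 !(@mset0D formula).
by apply; rewrite mset0D; apply: Ax.
Qed.

Lemma and_right (H : hypersequent) (Γ : {mset formula}) (A B : formula) :
  GIUL (H ∥ Γ ⇒ [mset A]) -> GIUL (H ∥ Γ ⇒ [mset B]) ->
  GIUL (H ∥ Γ ⇒ [mset (A ∧ B)%F]).
Proof. by have := @RAnd H Γ mset0 A B; rewrite !msetD0. Qed.

Lemma or_left (H : hypersequent) (Δ : {mset formula}) (A B : formula) :
  GIUL (H ∥ [mset A] ⇒ Δ) -> GIUL (H ∥ [mset B] ⇒ Δ) ->
  GIUL (H ∥ [mset (A ∨ B)%F] ⇒ Δ).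
Proof. by have := @LOr H mset0 Δ A B; rewrite !msetD0. Qed.

(** Each component splits into an identity and a proper inequality; only the
    pair of the two proper inequalities is not an axiom, and it is an instance
    of linearity. *)
Lemma and_selective (A B : formula) :
  GIUL (mset0 ∥ [mset A] ⇒ [mset (A ∧ B)%F] ∥ [mset B] ⇒ [mset (A ∧ B)%F]).
Proof.
apply: and_right; last exact: ax_weak.
apply: hyper_swap; apply: and_right; first exact: ax_weak.
exact: linearity.
Qed.

Lemma or_selective (A B : formula) :
  GIUL (mset0 ∥ [mset (A ∨ B)%F] ⇒ [mset A] ∥ [mset (A ∨ B)%F] ⇒ [mset B]).
Proof.
apply: or_left; last exact: ax_weak.
apply: hyper_swap; apply: or_left; first exact: ax_weak.
exact: linearity.
Qed.

(** * Monotone modalities *)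

(** The side hypersequent [H] matters: monotonicity has to be applied to one
    component of a derivable hypersequent none of whose components need be
    derivable alone. *)
Definition monotone (M : formula -> formula) : Prop :=
  forall (H : hypersequent) (A B : formula),
    GIUL (H ∥ [mset A] ⇒ [mset B]) -> GIUL (H ∥ [mset M A] ⇒ [mset M B]).

Lemma monotone2 (M : formula -> formula) (A B C D : formula) :
  monotone M ->
  GIUL (mset0 ∥ [mset A] ⇒ [mset B] ∥ [mset C] ⇒ [mset D]) ->
  GIUL (mset0 ∥ [mset M A] ⇒ [mset M B] ∥ [mset M C] ⇒ [mset M D]).
Proof.
by move=> monoM /monoM /hyper_swap /monoM /hyper_swap.
Qed.

Lemma derivable_imp (A B : formula) :
  GIUL (mset0 ∥ [mset A] ⇒ [mset B]) -> derivable (A → B).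
Proof.
have := @RImp mset0 mset0 mset0 A B.
rewrite !msetD0 => d /d.
by rewrite mset0D.
Qed.

Lemma monotone_and (M : formula -> formula) (A B : formula) :
  monotone M -> derivable ((M A ∧ M B) → M (A ∧ B)%F).
Proof.
move=> monoM; apply: derivable_imp; apply: EC.
have := @LAnd2 (mset0 ∥ [mset (M A ∧ M B)%F] ⇒ [mset M (A ∧ B)%F])
  mset0 [mset M (A ∧ B)%F] (M A) (M B).
rewrite !msetD0; apply; apply: hyper_swap.
have := @LAnd1 (mset0 ∥ [mset M B] ⇒ [mset M (A ∧ B)%F])
  mset0 [mset M (A ∧ B)%F] (M A) (M B).
rewrite !msetD0; apply; apply: hyper_swap.
exact: monotone2 (and_selective A B).
Qed.

Lemma monotone_or (M : formula -> formula) (A B : formula) :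
  monotone M -> derivable (M (A ∨ B)%F → (M A ∨ M B)).
Proof.
move=> monoM; apply: derivable_imp; apply: EC.
have := @ROr2 (mset0 ∥ [mset M (A ∨ B)%F] ⇒ [mset (M A ∨ M B)%F])
  [mset M (A ∨ B)%F] mset0 (M A) (M B).
rewrite !msetD0; apply; apply: hyper_swap.
have := @ROr1 (mset0 ∥ [mset M (A ∨ B)%F] ⇒ [mset M B])
  [mset M (A ∨ B)%F] mset0 (M A) (M B).
rewrite !msetD0; apply; apply: hyper_swap.
exact: monotone2 (or_selective A B).
Qed.

(** * The Tarskian modalities *)

(** The rules for [◇ A] are those for [A ⊕ A], and the rules for [⊡ A] are
    those for [A ⊗ A]. *)
Lemma diamond_right (H : hypersequent) (Γ Δ : {mset formula}) (A : formula) :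
  GIUL (H ∥ Γ ⇒ A +` (A +` Δ)) -> GIUL (H ∥ Γ ⇒ (◇ A)%F +` Δ).
Proof. by move=> d; apply: RImp; apply: LNot. Qed.

Lemma diamond_left (H : hypersequent) (Γ Γ' Δ Δ' : {mset formula})
    (A : formula) :
  GIUL (H ∥ A +` Γ ⇒ Δ) -> GIUL (H ∥ A +` Γ' ⇒ Δ') ->
  GIUL (H ∥ (◇ A)%F +` (Γ `+` Γ') ⇒ Δ `+` Δ').
Proof. by move=> d d'; apply: LImp => //; apply: RNot. Qed.

Lemma boxdot_left (H : hypersequent) (Γ Δ : {mset formula}) (A : formula) :
  GIUL (H ∥ A +` (A +` Γ) ⇒ Δ) -> GIUL (H ∥ (⊡ A)%F +` Γ ⇒ Δ).
Proof.
by move=> d; apply: LNot; apply: diamond_right; do 2!apply: RNot.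
Qed.

Lemma boxdot_right (H : hypersequent) (Γ Γ' Δ Δ' : {mset formula})
    (A : formula) :
  GIUL (H ∥ Γ ⇒ A +` Δ) -> GIUL (H ∥ Γ' ⇒ A +` Δ') ->
  GIUL (H ∥ Γ `+` Γ' ⇒ (⊡ A)%F +` (Δ `+` Δ')).
Proof.
by move=> d d'; apply: RNot; apply: diamond_left; apply: LNot.
Qed.

Lemma diamond_monotone : monotone diamond.
Proof.
move=> H A B d.
have := @diamond_right H [mset (◇ A)%F] mset0 B.
have := @diamond_left H mset0 mset0 [mset B] [mset B] A.
by rewrite !msetD0 => l; apply; apply: l.
Qed.

Lemma boxdot_monotone : monotone boxdot.
Proof.
move=> H A B d.
have := @boxdot_left H mset0 [mset (⊡ B)%F] A.
have := @boxdot_right H [mset A] [mset A] mset0 mset0 B.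
by rewrite !msetD0 => r; apply; apply: r.
Qed.

Theorem mainTheorem15 (A B : formula) :
  [/\ derivable ((⊡ A ∧ ⊡ B) → ⊡ (A ∧ B)),
      derivable ((◇ A ∧ ◇ B) → ◇ (A ∧ B)),
      derivable (⊡ (A ∨ B) → (⊡ A ∨ ⊡ B))
    & derivable (◇ (A ∨ B) → (◇ A ∨ ◇ B))].
Proof.
split.
- exact: monotone_and boxdot_monotone.
- exact: monotone_and diamond_monotone.
- exact: monotone_or boxdot_monotone.
- exact: monotone_or diamond_monotone.
Qed.
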